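(* For every $n\ge 6$ the Star graph $S_n$ contains a perfect code which is a union of left cosets $\pi\,\mathrm{PGL}(2,5)$, $\pi\in\mathrm{Sym}_n$, where $\mathrm{PGL}(2,5)$ is embedded in $\mathrm{Sym}_6\le\mathrm{Sym}_n$ via its action on the $6$ projective points.
   Context: $\mathrm{Sym}_n$ is the symmetric group on $\{1,\ldots,n\}$; $\mathrm{Sym}_6$ is regarded as the subgroup of $\mathrm{Sym}_n$ fixing every element of $\{7,\ldots,n\}$. For a group $G$ with an inverse-closed generating set $H$ not containing the identity, the Cayley graph $\Gamma(G,H)$ has vertex set $G$ and edge set $\{(hg,g): g\in G,\ h\in H\}$. The Star graph is $S_n=\Gamma(\mathrm{Sym}_n,\{(1\ i):2\le i\le n\})$; it is $(n-1)$-regular. A code in a graph is a subset $C$ of its vertices; its minimum distance is $\min_{x,y\in C,\,x\ne y}d(x,y)$, where $d$ is the graph distance. A code $C$ in a $k$-regular graph with vertex set $V$ is perfect if its minimum distance is $3$ and $|C|=|V|/(k+1)$. $\mathrm{PGL}(2,5)$ is the projective linear group induced by the action of $\mathrm{GL}(2,5)$ on the six $1$-dimensional subspaces (projective points) of a $2$-dimensional vector space over the field with $5$ elements. The projective points are enumerated (by an arbitrary fixed bijection) by the elements of $\{1,\ldots,6\}$, so $\mathrm{PGL}(2,5)$ is a subgroup of $\mathrm{Sym}_6$. The left coset of $\mathrm{PGL}(2,5)$ by $\pi$ is $\{\pi g: g\in\mathrm{PGL}(2,5)\}$. *)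

(* Defs.v *)
From mathcomp Require Import all_boot all_order all_fingroup all_algebra.

Set Implicit Arguments.
Unset Strict Implicit.
Unset Printing Implicit Defensive.

(* A graph on a finite vertex type T is given by its adjacency relation. *)
Section Codes.
Variables (T : finType) (e : rel T).

(* Relational, so that a pair of vertices in different connected components
   has no distance at all (rather than a junk value). *)
Definition is_dist (x y : T) (d : nat) : Prop :=
  (exists p : seq T, [/\ path e x p, last x p = y & size p = d])
  /\ (forall p : seq T, path e x p -> last x p = y -> d <= size p).

Definition is_min_dist (C : {set T}) (d : nat) : Prop :=
  (exists x y : T, [/\ x \in C, y \in C, x != y & is_dist x y d])
  /\ (forall (x y : T) (d' : nat),
        x \in C -> y \in C -> x != y -> is_dist x y d' -> d <= d').

Definition regular_graph (k : nat) : Prop :=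
  forall x : T, #|[set y | e x y]| = k.

Definition perfect_code (k : nat) (C : {set T}) : Prop :=
  [/\ regular_graph k, is_min_dist C 3
    & (#|C|%:R = #|T|%:R / k.+1%:R :> rat)%R].

End Codes.

Definition cayley (gT : finGroupType) (H : {set gT}) : rel gT :=
  [rel x y | [exists h in H, x == (h * y)%g]].

(* The points 1, ..., n are encoded as 0, ..., n - 1 in 'I_n.
   The product s * t of 'S_n is "s, then t". The opposite convention gives the
   same notions up to the map s |-> s^-1, which fixes every transposition and
   carries Cayley edges {h g, g}, subgroups and left cosets pi P to Cayley
   edges, the same subgroups and left cosets for the opposite product. *)
Definition star_gens (n : nat) : {set 'S_n} :=
  [set tperm i j | i in [set i : 'I_n | val i == 0],
                   j in [set j : 'I_n | val j != 0]].

Definition star_graph (n : nat) : rel 'S_n := cayley (star_gens n).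
Arguments star_graph n : clear implicits.

Definition proj_point : Type :=
  {U : {vspace 'rV['F_5]_2} | \dim U == 1}.

Definition gl_image (g : {'GL_2['F_5]}) (U : {vspace 'rV['F_5]_2}) :
    {vspace 'rV['F_5]_2} :=
  (linfun (mulmxr (GLval g)) @: U)%VS.

(* pt is the enumeration of the projective points, assumed bijective wherever
   this definition is used. *)
Definition PGL25 (pt : 'I_6 -> proj_point) : {set 'S_6} :=
  [set s : 'S_6 | [exists g in 'GL_2(5)%g,
      [forall i, val (pt (s i)) == gl_image g (val (pt i))]]].

Definition extends_perm (n : nat) (hn : 6 <= n) (s : 'S_6) (t : 'S_n) : bool :=
  [forall i : 'I_6, t (widen_ord hn i) == widen_ord hn (s i)]
  && [forall j : 'I_n, (6 <= j) ==> (t j == j)].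

(* The image of A under the embedding of Sym_6 in Sym_n. *)
Definition Sym6_embed (n : nat) (hn : 6 <= n) (A : {set 'S_6}) : {set 'S_n} :=
  [set t : 'S_n | [exists s in A, extends_perm hn s t]].

(* Main.v *)
Require Import Defs.
From mathcomp Require Import all_boot all_order all_fingroup all_algebra.

Set Implicit Arguments.
Unset Strict Implicit.
Unset Printing Implicit Defensive.

(** Let [H_m] consist of the identity and the transpositions [(0 j)], [0 < j < m].
    A set [C] of [(m - 1)!] permutations is a perfect code of the Star graph
    [S_m] as soon as [H_m * C] is all of [Sym_m], since by counting the
    factorisation is then unique.

    For [m = 6] take [C = PGL(2,5)]: a matrix stabilising three lines
    of a plane is scalar, hence two elements of [PGL(2,5)] that agree at three
    points are equal, and [|PGL(2,5)| = |GL(2,5)| / 4 = 120]; so [H_6 x PGL(2,5)] injects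
    into [Sym_6] and fills it.  From [m] to [m + 1] replace [C] by [T_m * C],
    where [T_m] consists of the [m] permutations [(k m)], [0 < k <= m]; this
    works because [(k m)(0 j)], for [k <= m] and [j < m], always lies in
    [H_(m+1) * T_m].  All new factors are on the left, so the code remains a
    union of left cosets of [PGL(2,5)]. *)

(** * Endomorphisms of a plane that stabilise three lines *)

Section StabilisedLines.
Import GRing.Theory.
Local Open Scope ring_scope.

Lemma vpick_line (F : fieldType) (vT : vectType F) (U : {vspace vT}) :
  \dim U = 1%N -> U = <[vpick U]>%VS.
Proof.
move=> dU; apply/esym/eqP; rewrite eqEdim -memvE memv_pick dU dim_vline vpick0.
by rewrite -dimv_eq0 dU.
Qed.

Lemma stabilised_line (F : fieldType) (vT : vectType F) (f : 'End(vT)) u :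
  (f @: <[u]> <= <[u]>)%VS -> exists a, f u = a *: u.
Proof. by rewrite limg_line -memvE => /vlineP[a ->]; exists a. Qed.

(** Spanning vectors [u], [v] of [U], [V] form a basis of eigenvectors. A spanning vector [w] of [W]
    is also an eigenvector, and both its coordinates are nonzero because [W] differs from [U] and
    [V]; so its eigenvalue equals the other two. *)
Lemma three_stabilised_lines (F : fieldType) (vT : vectType F) (f : 'End(vT))
    (U V W : {vspace vT}) :
    dim vT = 2%N -> \dim U = 1%N -> \dim V = 1%N -> \dim W = 1%N ->
    U != V -> W != U -> W != V ->
    (f @: U <= U)%VS -> (f @: V <= V)%VS -> (f @: W <= W)%VS ->
  exists a, forall x, f x = a *: x.
Proof.
move=> d2 dU dV dW UV WU WV.
have lines_cap0 (X Y : {vspace vT}) :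
    \dim X = 1%N -> \dim Y = 1%N -> X != Y -> (X :&: Y = 0)%VS.
  move=> dX dY XY; apply/eqP; rewrite -dimv_eq0; apply: contraNT XY => nz.
  have d1 : (1 <= \dim (X :&: Y))%N by rewrite lt0n.
  have /eqP EX : (X :&: Y)%VS == X by rewrite eqEdim capvSl dX.
  have /eqP EY : (X :&: Y)%VS == Y by rewrite eqEdim capvSr dY.
  by rewrite -EX EY.
have UV0 := lines_cap0 _ _ dU dV UV.
have UVfull : (U + V = fullv)%VS.
  apply/eqP; rewrite eqEdim subvf dimvf d2.
  by rewrite dimv_disjoint_sum // dU dV.
have EU := vpick_line dU; have EV := vpick_line dV; have EW := vpick_line dW.
set u := vpick U in EU; set v := vpick V in EV; set w := vpick W in EW.
rewrite {1 2}EU {1 2}EV {1 2}EW => /stabilised_line[l fu] /stabilised_line[m fv].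
move=> /stabilised_line[c fw].
have free_uv a b : a *: u + b *: v = 0 -> a = 0 /\ b = 0.
  move=> /eqP; rewrite addr_eq0 => /eqP E.
  have au : a *: u \in (U :&: V)%VS.
    by rewrite memv_cap {1}EU memvZ ?memv_line //= E EV -scaleNr memvZ ?memv_line.
  move: au; rewrite UV0 memv0 => /eqP au; rewrite au in E.
  have unz : u != 0 by rewrite vpick0 -dimv_eq0 dU.
  have vnz : v != 0 by rewrite vpick0 -dimv_eq0 dV.
  move/eqP: au; rewrite scaler_eq0 (negPf unz) orbF => /eqP ->; split=> //.
  by move/esym/eqP: E; rewrite oppr_eq0 scaler_eq0 (negPf vnz) orbF => /eqP.
have decomp x : exists a b, x = a *: u + b *: v.
  have : x \in (U + V)%VS by rewrite UVfull memvf.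
  case/memv_addP=> x1; rewrite EU => /vlineP[a ->] [x2].
  by rewrite EV => /vlineP[b ->] ->; exists a, b.
have [a [b wE]] := decomp w.
have anz : a != 0.
  apply: contra_neq WV => a0; rewrite a0 scale0r add0r in wE.
  apply/eqP; rewrite eqEdim dV dW leqnn andbT EW wE EV -memvE.
  by rewrite memvZ ?memv_line.
have bnz : b != 0.
  apply: contra_neq WU => b0; rewrite b0 scale0r addr0 in wE.
  apply/eqP; rewrite eqEdim dU dW leqnn andbT EW wE EU -memvE.
  by rewrite memvZ ?memv_line.
(* This is [f w - c *: w = 0] written in the basis [u], [v]. *)
have /free_uv[/eqP] : ((l - c) * a) *: u + ((m - c) * b) *: v = 0.
  move: fw; rewrite wE linearD !linearZ /= fu fv scalerDr !scalerA => fw.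
  rewrite !mulrBl !scalerBl addrACA -opprD -fw.
  by rewrite [l * a]mulrC [m * b]mulrC subrr.
rewrite mulf_eq0 (negPf anz) orbF subr_eq0 => /eqP lc /eqP.
rewrite mulf_eq0 (negPf bnz) orbF subr_eq0 => /eqP mc.
exists c => x; have [a' [b' ->]] := decomp x.
rewrite linearD !linearZ /= fu fv lc mc scalerDr !scalerA.
by rewrite [a' * c]mulrC [b' * c]mulrC.
Qed.

End StabilisedLines.

(** * Products of sets and the inductive covering of the symmetric groups *)

Lemma leq_card_mulg (gT : finGroupType) (A B : {set gT}) :
  #|(A * B)%g| <= #|A| * #|B|.
Proof.
rewrite -cardsX; apply: leq_trans (leq_imset_card (fun z => z.1 * z.2)%g _).
apply/subset_leq_card/subsetP=> _ /mulsgP[a b aA bB ->].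
by apply/imsetP; exists (a, b); rewrite ?inE ?aA.
Qed.

Section StarCover.
Variable n : nat.
Implicit Types (i j k : 'I_n.+1) (x t : 'S_n.+1) (A B : {set 'S_n.+1}).
Local Open Scope group_scope.

(** The set [H_m]: the index 0 contributes [tperm ord0 ord0 = 1]. All levels [m] live in the one
    group ['S_n.+1], so the induction never changes the type. *)
Definition star_ball m : {set 'S_n.+1} := [set tperm ord0 (inord j) | j : 'I_m].

(** This plays the role of [Sym_m] inside ['S_n.+1]. *)
Definition fixes_from m : {set 'S_n.+1} :=
  [set x : 'S_n.+1 | [forall j : 'I_n.+1, (m <= j) ==> (x j == j)]].

(** The set [T_k]: the shift [j.+1] leaves out [(0 k)], while the last index gives [(k k) = 1]. *)
Definition last_swaps k : {set 'S_n.+1} := [set tperm (inord j.+1) k | j : 'I_k].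

Lemma star_ballP m x : m <= n.+1 ->
  reflect (exists2 j : 'I_n.+1, j < m & x = tperm ord0 j) (x \in star_ball m).
Proof.
move=> mn; apply: (iffP imsetP) => [[j _ ->] | [j jm ->]].
  by exists (inord j); rewrite // inordK // (leq_trans (ltn_ord j)).
by exists (Ordinal jm); rewrite //= inord_val.
Qed.

Lemma tperm0_inj : injective (tperm (ord0 : 'I_n.+1)).
Proof. by move=> i j /permP/(_ ord0); rewrite !tpermL. Qed.

Lemma card_star_ball m : m <= n.+1 -> #|star_ball m| = m.
Proof.
move=> mn; rewrite card_imset ?card_ord // => i j /tperm0_inj/(congr1 val)/=.
by rewrite !inordK ?(leq_trans (ltn_ord _)) // => /val_inj.
Qed.

Lemma mem_last_swaps j k : 0 < j <= k -> tperm j k \in last_swaps k.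
Proof.
case: j => -[|j] //= jn jk; apply/imsetP; exists (Ordinal (jk : j < k)) => //=.
by congr (tperm _ _); apply: val_inj; rewrite /= inordK.
Qed.

Lemma card_last_swaps k : #|last_swaps k| <= k.
Proof. by rewrite -[X in _ <= X]card_ord leq_imset_card. Qed.

Lemma fixes_fromP m x : reflect (forall j : 'I_n.+1, m <= j -> x j = j) (x \in fixes_from m).
Proof.
rewrite inE; apply: (iffP forallP) => H j; first by move=> mj; apply/eqP/(implyP (H j)).
by apply/implyP=> mj; apply/eqP/H.
Qed.

(** Conjugation by [(0 j)] fixes [M] and turns [(k M)] into [(k' M)], where [k'] is 0 only if
    [k = j]. In that exceptional case [(j M)(0 j) = (0 M)(j M)] if [j] is nonzero, and for [j = 0]
    the product is [(0 M)(M M)]. *)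
Lemma swap_star_ball (M k j : 'I_n.+1) : 0 < M -> k <= M -> j < M ->
  tperm k M * tperm ord0 j \in star_ball M.+1 * last_swaps M.
Proof.
move=> M0 kM jM.
suff [j' [k' [jM' k0 kM' ->]]] : exists j' k' : 'I_n.+1,
    [/\ j' <= M, 0 < k', k' <= M & tperm k M * tperm ord0 j = tperm ord0 j' * tperm k' M].
  apply: mem_mulg; last by rewrite mem_last_swaps ?k0.
  by apply/star_ballP=> //; exists j'.
have neqM i : i < M -> (i == M) = false by move=> iM; rewrite -val_eqE ltn_eqF.
have M0' : (ord0 == M) = false by rewrite neqM.
have [->|kj] := eqVneq k j.
  have [->|j0] := eqVneq j ord0; first by exists M, M; rewrite !tperm1 mulg1.
  exists M, j; split; rewrite ?lt0n ?(ltnW jM) //.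
  have <- : tperm ord0 j ^ tperm j M = tperm ord0 M.
    by rewrite tpermJ tpermL tpermD // eq_sym ?M0'.
  by rewrite conjgE tpermV -!mulgA tperm2 mulg1.
exists j, (tperm ord0 j k); split; [exact: ltnW | | | ].
- rewrite lt0n; apply: contra_neq kj => /(val_inj (u2 := ord0))/(canRL (tpermK _ _)).
  by rewrite tpermL.
- by case: tpermP => *; rewrite ?(ltnW jM).
- by rewrite conjgC tpermJ [tperm _ _ M]tpermD ?M0' ?neqM.
Qed.

(** If [x] sends [k] to [M], then [(k M) x] fixes [M], so the given covering writes it as [(0 j) c].
    Thus [x = (k M)(0 j) c], and the first two factors can be exchanged by [swap_star_ball]. *)
Lemma fixes_from_step (M : 'I_n.+1) A : 0 < M ->
  fixes_from M \subset star_ball M * A ->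
  fixes_from M.+1 \subset star_ball M.+1 * (last_swaps M * A).
Proof.
move=> M0 covM; apply/subsetP=> x /fixes_fromP fx.
pose k := x^-1 M.
have xk : x k = M by rewrite /k permKV.
have kM : k <= M.
  rewrite leqNgt; apply/negP=> Mk; move: (fx k Mk).
  by rewrite xk => E; rewrite -E ltnn in Mk.
have : tperm k M * x \in fixes_from M.
  apply/fixes_fromP=> j; rewrite permM leq_eqVlt => /predU1P[/val_inj <-|Mj].
    by rewrite tpermR.
  rewrite tpermD ?fx //; rewrite -val_eqE ?ltn_eqF //.
  exact: leq_ltn_trans Mj.
move/(subsetP covM)/mulsgP=> [h c hH cA E].
have [j jM Eh] := star_ballP _ (ltnW (ltn_ord M)) hH; rewrite {h hH}Eh in E.
have -> : x = tperm k M * tperm ord0 j * c by rewrite -mulgA -E mulgA tperm2 mul1g.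
by rewrite mulgA mem_mulg // swap_star_ball.
Qed.

(** [B] is the product of the sets [T_n], ..., [T_m] in this order, with at most [n! / (m - 1)!]
    elements. It is built independently of the elements of [A], which remains the rightmost
    factor. *)
Lemma star_swap_cover m (A : {set 'S_n.+1}) : 1 <= m <= n.+1 ->
  fixes_from m \subset star_ball m * A ->
  exists B : {set 'S_n.+1}, #|B| * (m.-1)`! <= n`! /\
    star_ball n.+1 * (B * A) = setT.
Proof.
case/andP=> m1 mn covA.
have [r rE] : exists r, (m + r)%N = n.+1 by exists (n.+1 - m)%N; rewrite subnKC.
suff /(_ r)[|B [cB covB]] : forall r, m + r <= n.+1 ->
    exists B : {set 'S_n.+1}, #|B| * (m.-1)`! <= (m + r).-1`! /\
      fixes_from (m + r) \subset star_ball (m + r) * (B * A).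
- by rewrite rE.
- rewrite rE in cB covB; exists B; split=> //.
  apply/eqP; rewrite -subTset; apply: subset_trans covB.
  apply/subsetP=> x _; apply/fixes_fromP=> j.
  by rewrite leqNgt ltn_ord.
elim=> [|{rE}r IH] mr.
  by exists [set 1]; rewrite addn0 cards1 mul1n mul1g.
have [|B [cB covB]] := IH; first by rewrite addnS in mr; exact: ltnW.
rewrite addnS in mr *.
pose M := Ordinal mr.
exists (last_swaps M * B); split; last first.
  rewrite -mulgA; apply: (@fixes_from_step M) => //=.
  by rewrite addn_gt0 m1.
have M0 : 0 < m + r by rewrite addn_gt0 m1.
have -> : ((m + r).+1.-1)`! = ((m + r) * ((m + r).-1)`!)%N.
  by rewrite /= -{1}(prednK M0) factS prednK.
apply: leq_trans (leq_mul (leq_trans (leq_card_mulg _ _) _) (leqnn _)) _.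
  exact: leq_mul (card_last_swaps M) (leqnn _).
by rewrite -mulnA leq_mul.
Qed.

End StarCover.

(** * From a covering by unit balls to a perfect code *)

Section PerfectStarCode.
Variable n : nat.
Implicit Types (i j k : 'I_n.+1) (x y h : 'S_n.+1) (C : {set 'S_n.+1}).
Local Open Scope group_scope.

Lemma star_graphP x y :
  reflect (exists2 j, j != ord0 & x = tperm ord0 j * y) (star_graph n.+1 x y).
Proof.
apply: (iffP existsP) => [[h /andP[/imset2P[i j]]] | [j j0 ->]].
  rewrite !inE => /eqP i0 j0 -> /eqP ->; exists j => //.
  by congr (tperm _ _ * _); apply: val_inj.
exists (tperm ord0 j); rewrite eqxx andbT; apply/imset2P.
by exists ord0 j; rewrite ?inE.
Qed.

Lemma mem_star_ball j : tperm ord0 j \in star_ball n n.+1.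
Proof. by apply/star_ballP => //; exists j. Qed.

Lemma star_graph_sym : symmetric (star_graph n.+1).
Proof.
suff H x y : star_graph n.+1 x y -> star_graph n.+1 y x by move=> x y; apply/idP/idP; exact: H.
by case/star_graphP=> j j0 ->; apply/star_graphP; exists j; rewrite // mulgA tperm2 mul1g.
Qed.

Lemma star_graph_regular : regular_graph (star_graph n.+1) n.
Proof.
move=> x.
have -> : [set y | star_graph n.+1 x y] = [set tperm ord0 j * x | j in [set~ ord0]].
  apply/setP=> y; rewrite inE star_graph_sym; apply/star_graphP/imsetP => -[j].
    by move=> j0 ->; exists j; rewrite // !inE.
  by rewrite !inE => j0 ->; exists j.
rewrite card_imset; first by rewrite cardsC1 card_ord.
by move=> i j /mulIg/(@tperm0_inj n).
Qed.

Lemma perfect_star_code C : 1 < n -> #|C| <= n`! ->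
  star_ball n n.+1 * C = setT -> perfect_code (star_graph n.+1) n C.
Proof.
move=> n1 leC cov.
have cardH : #|star_ball n n.+1| = n.+1 by rewrite card_star_ball.
have cardS : #|{: 'S_n.+1}| = (n.+1)`! by exact: card_Sn.
have cardC : #|C| = n`!.
  apply/eqP; rewrite eqn_leq leC -(leq_pmul2l (ltn0Sn n)) -factS.
  have := leq_card_mulg (star_ball n n.+1) C.
  by rewrite cov cardsT cardS cardH.
(* Multiplication maps [H x C] onto the whole group, and both have [(n + 1)!] elements; hence it is
   injective. *)
have uniq h h' x y : h \in star_ball n n.+1 -> h' \in star_ball n n.+1 ->
    x \in C -> y \in C -> h * x = h' * y -> h = h' /\ x = y.
  move=> Hh Hh' Cx Cy E.
  have /imset_injP inj : #|[set z.1 * z.2 | z in setX (star_ball n n.+1) C]|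
      == #|setX (star_ball n n.+1) C|.
    have -> : [set z.1 * z.2 | z in setX (star_ball n n.+1) C] = setT.
      apply/setP=> z; rewrite inE.
      have /mulsgP[a b Ha Cb ->] : z \in star_ball n n.+1 * C by rewrite cov inE.
      by apply/imsetP; exists (a, b); rewrite ?inE ?Ha.
    by rewrite cardsT cardS cardsX cardC cardH factS.
  suff [-> ->] : (h, x) = (h', y) by [].
  by apply: inj; rewrite ?inE /= ?Hh ?Hh'.
(* A path of length 1 gives [1 x = (0 j) y] and one of length 2 gives [(0 j) x = (0 k) y]; unique
   factorisation then forces [x = y]. *)
have far x y p : x \in C -> y \in C -> x != y ->
    path (star_graph n.+1) x p -> last x p = y -> 3 <= size p.
  move=> Cx Cy xy; case: p => [|a [|b [|c p]]] //=.
  - by move=> _ E; rewrite E eqxx in xy.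
  - case/andP=> /star_graphP[j j0 E] _ Ea; rewrite {a}Ea in E.
    suff [_ Exy] : 1 = tperm ord0 j /\ x = y by rewrite Exy eqxx in xy.
    apply: uniq; rewrite ?mem_star_ball ?mul1g //.
    by rewrite -(tperm1 ord0) mem_star_ball.
  - case/and3P=> /star_graphP[j j0 Ex] /star_graphP[k k0 Ea] _ Eb.
    rewrite {b}Eb in Ea.
    suff [_ Exy] : tperm ord0 j = tperm ord0 k /\ x = y by rewrite Exy eqxx in xy.
    by apply: uniq; rewrite ?mem_star_ball // -Ea Ex mulgA tperm2 mul1g.
split; first exact: star_graph_regular.
  split; last by move=> x y d Cx Cy xy [[p [pp Ep <-]] _]; exact: far Cx Cy xy pp Ep.
  have /card_gt0P[x Cx] : 0 < #|C| by rewrite cardC fact_gt0.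
  pose i1 : 'I_n.+1 := inord 1; pose i2 : 'I_n.+1 := inord 2.
  have v1 : i1 = 1%N :> nat by rewrite inordK // ltnS ltnW.
  have v2 : i2 = 2 :> nat by rewrite inordK // ltnS.
  have i10 : i1 != ord0 by rewrite -val_eqE /= v1.
  have i20 : i2 != ord0 by rewrite -val_eqE /= v2.
  have i12 : i1 != i2 by rewrite -val_eqE /= v1 v2.
  (* Distance 3 is attained: [z] is two steps from the codeword [x], and the covering gives a
     codeword [y] with [z = (0 j) y]. Here [y] is not [x], as [(0 1)(0 2)] is not of the form
     [(0 j)], and [j] is not 0 by unique factorisation. So [x], [(0 2) x], [z], [y] is a path. *)
  pose z := tperm ord0 i1 * (tperm ord0 i2 * x).
  have /mulsgP[h y Hh Cy zE] : z \in star_ball n n.+1 * C by rewrite cov inE.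
  have [j _ hE] := star_ballP _ (leqnn _) Hh; rewrite {h Hh}hE in zE.
  have z0 : (tperm ord0 i1 * tperm ord0 i2) ord0 = i1.
    by rewrite permM tpermL; apply: tpermD; rewrite // eq_sym.
  have z2 : (tperm ord0 i1 * tperm ord0 i2) i2 = ord0.
    by rewrite permM [tperm _ i1 _]tpermD ?tpermR // eq_sym.
  have xy : x != y.
    apply/eqP=> xy; move: zE; rewrite /z mulgA xy => /mulIg E.
    have := congr1 (fun s : 'S_n.+1 => s ord0) E; rewrite z0 tpermL => E1.
    have := congr1 (fun s : 'S_n.+1 => s i2) E; rewrite z2 -E1 tpermD // => [E2|]; last by rewrite eq_sym.
    by rewrite -E2 eqxx in i20.
  have [j0|j0] := eqVneq j ord0.
    have E : tperm ord0 i2 * x = tperm ord0 i1 * y.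
      by rewrite -[LHS]mul1g -(tperm2 ord0 i1) -mulgA -/z zE j0 tperm1 mul1g.
    case/uniq: E; rewrite ?mem_star_ball // => _ Exy.
    by rewrite Exy eqxx in xy.
  exists x, y; split=> //; split; last by move=> p; exact: far.
  exists [:: tperm ord0 i2 * x; z; y]; split=> //=; rewrite andbT.
  apply/and3P; split; last by apply/star_graphP; exists j.
    by rewrite star_graph_sym; apply/star_graphP; exists i2.
  by rewrite star_graph_sym; apply/star_graphP; exists i1.
rewrite cardC cardS factS GRing.natrM GRing.mulrAC GRing.mulfV ?GRing.mul1r //.
by rewrite Num.Theory.pnatr_eq0.
Qed.

End PerfectStarCode.

(** * The embedding of [Sym_6] in [Sym_n] as an explicit morphism *)

Section Embedding.
Variable n : nat.
Hypothesis hn : 6 <= n.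
Local Open Scope group_scope.

Definition extend_fun (s : 'S_6) (i : 'I_n) : 'I_n :=
  if i < 6 then widen_ord hn (s (inord i)) else i.

Lemma extend_fun_inj s : injective (extend_fun s).
Proof.
move=> i j; rewrite /extend_fun.
case: ifP => hi; case: ifP => hj //.
- move/(congr1 val)=> /= /val_inj/perm_inj/(congr1 val).
  by rewrite /= !inordK // => /val_inj.
- by move=> E; rewrite -E /= ltn_ord in hj.
- by move=> E; rewrite E /= ltn_ord in hi.
Qed.

Definition extend (s : 'S_6) : 'S_n := perm (@extend_fun_inj s).

Lemma extend_low s (i : 'I_6) : extend s (widen_ord hn i) = widen_ord hn (s i).
Proof.
rewrite permE /extend_fun /= ltn_ord.
by congr (widen_ord _ (s _)); apply: val_inj; rewrite /= inordK.
Qed.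

Lemma extend_high s (j : 'I_n) : 6 <= j -> extend s j = j.
Proof. by move=> hj; rewrite permE /extend_fun ltnNge hj. Qed.

Lemma low_or_high (j : 'I_n) : (exists i : 'I_6, j = widen_ord hn i) \/ 6 <= j.
Proof.
case: (ltnP j 6) => hj; [left | by right].
by exists (Ordinal hj); apply: val_inj.
Qed.

Lemma extendsP s (t : 'S_n) : reflect (t = extend s) (extends_perm hn s t).
Proof.
apply: (iffP andP) => [[/forallP lo /forallP hi] | ->].
  apply/permP=> j; have [[i ->]|hj] := low_or_high j.
    by rewrite extend_low; apply/eqP.
  by rewrite extend_high //; apply/eqP; apply: (implyP (hi j)).
split; apply/forallP=> i; first by rewrite extend_low.
by apply/implyP=> hi; rewrite extend_high.
Qed.

Lemma Sym6_embedE (P : {set 'S_6}) : Sym6_embed hn P = extend @: P.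
Proof.
apply/setP=> t; rewrite inE; apply/existsP/imsetP => [[s /andP[Ps /extendsP]] | [s Ps ->]].
  by exists s.
by exists s; rewrite Ps; apply/extendsP.
Qed.

Lemma extendM s t : extend (s * t) = extend s * extend t.
Proof.
apply/permP=> j; rewrite permM; have [[i ->]|hj] := low_or_high j.
  by rewrite !extend_low permM.
by rewrite !extend_high.
Qed.

(** An image [t i >= 6] of a low point would itself be fixed by [t], whence [t i = i] by
    injectivity, a contradiction. So [t] restricts to the six low points. *)
Lemma fixes_from6_extend (t : 'S_n) :
  (forall j : 'I_n, 6 <= j -> t j = j) -> exists s, t = extend s.
Proof.
move=> ft.
have lt6 (i : 'I_6) : t (widen_ord hn i) < 6.
  rewrite ltnNge; apply/negP=> /[dup] h /ft /perm_inj E.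
  by rewrite E /= leqNgt ltn_ord in h.
have inj : injective (fun i : 'I_6 => Ordinal (lt6 i)).
  by move=> i j /(congr1 val)/= /val_inj/perm_inj/(congr1 val)/= /val_inj.
exists (perm inj); apply/esym/permP=> j; have [[i ->]|hj] := low_or_high j.
  by rewrite extend_low permE; apply: val_inj.
by rewrite extend_high ?ft.
Qed.

Lemma extend_tperm (i j : 'I_6) :
  extend (tperm i j) = tperm (widen_ord hn i) (widen_ord hn j).
Proof.
have inj : injective (widen_ord hn) by move=> a b /(congr1 val)/= /val_inj.
apply/permP=> k; have [[l ->]|hk] := low_or_high k.
  rewrite extend_low; case: (tpermP i j l) => [->|->|]; rewrite ?tpermL ?tpermR //.
  by move=> /eqP il /eqP jl; rewrite tpermD // (inj_eq inj) eq_sym.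
by rewrite extend_high // tpermD // -val_eqE /= ltn_eqF // (leq_trans (ltn_ord _)).
Qed.

End Embedding.

(** * The action of [GL(2,5)] on subspaces *)

Section GLAction.
Implicit Types (g h : {'GL_2['F_5]}) (U : {vspace 'rV['F_5]_2}).

(** Matrices multiply row vectors on the right, so [g] acts first, in accordance with the product of
    permutations. *)
Lemma gl_imageM g h U : gl_image (g * h)%g U = gl_image h (gl_image g U).
Proof.
rewrite /gl_image -limg_comp; congr (lfun_img _ _); apply/lfunP => v.
by rewrite comp_lfunE !lfunE /= mulmxA.
Qed.

Lemma gl_image1 U : gl_image 1%g U = U.
Proof.
rewrite -[RHS]lim1g /gl_image; congr (lfun_img _ _); apply/lfunP => v.
by rewrite id_lfunE lfunE /= mulmx1.
Qed.

Lemma gl_imageK g : cancel (gl_image g) (gl_image g^-1%g).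
Proof. by move=> U; rewrite -gl_imageM mulgV gl_image1. Qed.

(** A linear image never has larger dimension; this is applied to [g] and to its inverse. *)
Lemma dim_gl_image g U : \dim (gl_image g U) = \dim U.
Proof.
have le h V : \dim (gl_image h V) <= \dim V.
  by rewrite /gl_image -(limg_ker_dim (linfun (mulmxr (GLval h))) V) leq_addl.
by apply/eqP; rewrite eqn_leq le /= -{1}(gl_imageK g U) le.
Qed.

Lemma gl_stabilised_lines g U V W :
    \dim U = 1 -> \dim V = 1 -> \dim W = 1 -> U != V -> W != U -> W != V ->
    gl_image g U = U -> gl_image g V = V -> gl_image g W = W ->
  exists2 a : 'F_5, a != 0%R & GLval g = (a%:M)%R.
Proof.
move=> dU dV dW UV WU WV gU gV gW.
have stab X : gl_image g X = X -> (linfun (mulmxr (GLval g)) @: X <= X)%VS.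
  by move=> gX; rewrite -{2}gX subvv.
have d2 : dim 'rV['F_5]_2 = 2 by rewrite dim_matrix.
have [] := three_stabilised_lines d2 dU dV dW UV WU WV (stab _ gU) (stab _ gV) (stab _ gW).
move=> a ga.
have gE : GLval g = (a%:M)%R.
  apply/row_matrixP => i; have := ga (row i 1%:M)%R.
  by rewrite lfunE /= -row_mul mul1mx -GRing.linearZ /= scalemx1.
exists a => //; apply/eqP=> a0; have := GL_unit g.
by rewrite gE a0 GRing.raddf0 GRing.unitr0.
Qed.

End GLAction.

(** * The order of [PGL(2,5)] and the factorisation of [Sym_6] *)

Section ProjectiveLine.
Variables (pt : 'I_6 -> proj_point) (pt_bij : bijective pt).
Implicit Types (g h : {'GL_2['F_5]}) (s t : 'S_6).
Local Open Scope group_scope.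

Definition induces g s := forall i, val (pt (s i)) = gl_image g (val (pt i)).

Lemma PGL25P s : reflect (exists g, induces g s) (s \in PGL25 pt).
Proof.
rewrite inE; apply: (iffP existsP) => [[g /andP[_ /forallP gs]] | [g gs]].
  by exists g => i; apply/eqP.
by exists g; rewrite inE; apply/forallP => i; rewrite gs.
Qed.

Lemma dim_pt i : \dim (val (pt i)) = 1%N.
Proof. by apply/eqP; exact: valP (pt i). Qed.

Lemma val_pt_inj : injective (fun i => val (pt i)).
Proof. by move=> i j /val_inj/(bij_inj pt_bij). Qed.

(** The matrix [g * h^-1] stabilises the three lines where [s] and [t] agree, hence is scalar. *)
Lemma induces_agree3 g h s t (i j k : 'I_6) : induces g s -> induces h t ->
    i != j -> k != i -> k != j -> s i = t i -> s j = t j -> s k = t k ->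
  exists2 a : 'F_5, a != 0%R & GLval g = (a *: GLval h)%R.
Proof.
move=> gs ht ij ki kj si sj sk.
have fix_gh l : s l = t l -> gl_image (g * h^-1) (val (pt l)) = val (pt l).
  by move=> sl; rewrite gl_imageM -gs sl ht gl_imageK.
have [a a0 ghE] := gl_stabilised_lines (dim_pt i) (dim_pt j) (dim_pt k)
  (contra_neq (@val_pt_inj _ _) ij) (contra_neq (@val_pt_inj _ _) ki)
  (contra_neq (@val_pt_inj _ _) kj) (fix_gh _ si) (fix_gh _ sj) (fix_gh _ sk).
exists a => //; rewrite -mul_scalar_mx -ghE.
by rewrite -[X in GLval X](mulgKV h g).
Qed.

Lemma gl_image_scale g h (a : 'F_5) U : a != 0%R -> GLval g = (a *: GLval h)%R ->
  gl_image g U = gl_image h U.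
Proof.
move=> a0 gE; apply/eqP; rewrite eqEdim !dim_gl_image leqnn andbT.
apply/subvP => _ /memv_imgP[v Uv ->]; rewrite lfunE /= gE -scalemxAr memvZ //.
by apply/memv_imgP; exists v; rewrite // lfunE.
Qed.

Lemma PGL25_agree3 s t (i j k : 'I_6) : s \in PGL25 pt -> t \in PGL25 pt ->
  i != j -> k != i -> k != j -> s i = t i -> s j = t j -> s k = t k -> s = t.
Proof.
move=> /PGL25P[g gs] /PGL25P[h ht] ij ki kj si sj sk.
have [a a0 ghE] := induces_agree3 gs ht ij ki kj si sj sk.
apply/permP=> l; apply: val_pt_inj.
by rewrite gs ht (gl_image_scale _ a0 ghE).
Qed.

Lemma gl_induces g : exists s, induces g s.
Proof.
have [qt ptK qtK] := pt_bij.
have dim_g i : \dim (gl_image g (val (pt i))) == 1%N by rewrite dim_gl_image dim_pt.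
pose f i := qt (Sub (gl_image g (val (pt i))) (dim_g i)).
have fE i : val (pt (f i)) = gl_image g (val (pt i)) by rewrite /f qtK SubK.
have f_inj : injective f.
  move=> i j /(congr1 (fun l => val (pt l))); rewrite !fE.
  by move/(can_inj (gl_imageK g))/val_pt_inj.
by exists (perm f_inj) => i; rewrite permE fE.
Qed.

(** The 480 matrices are partitioned by the permutation [phi g] that they induce. Each class
    consists of nonzero multiples of one matrix, so it has at most 4 elements. *)
Lemma PGL25_ge120 : 120 <= #|PGL25 pt|.
Proof.
pose phi g := [pick s : 'S_6 | [forall i : 'I_6, val (pt (s i)) == gl_image g (val (pt i))]].
have phiP g : exists2 s, phi g = Some s & induces g s.
  rewrite /phi; case: pickP => [s /forallP gs | no].
    by exists s => // i; apply/eqP.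
  have [s gs] := gl_induces g.
  by have /forallP[] := no s => i; rewrite gs.
rewrite -(leq_pmul2r (isT : 0 < 4)).
have <- : #|'GL_2['F_5]| = (120 * 4)%N by rewrite card_GL_2 card_Fp.
rewrite -sum1_card (partition_big phi [in [set Some s | s in PGL25 pt]]) /=; last first.
  move=> g _; have [s -> gs] := phiP g; apply: imset_f.
  by apply/PGL25P; exists g.
rewrite -(card_imset _ (@Some_inj _)) -sum_nat_const.
apply: leq_sum => _ /imsetP[s _ ->]; rewrite sum1_card.
have [h hs|no] := pickP [pred h | phi h == Some s]; last first.
  by rewrite eq_card0 // => g; apply: contraFF (no g) => /andP[].
(* The default [h] of [insubd] is taken only at [a = 0], which the index set below leaves out. *)
pose scale (a : 'F_5) := insubd h (a *: GLval h)%R.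
apply: (@leq_trans #|[set~ (0 : 'F_5)%R]|); last by rewrite cardsC1 card_Fp.
apply: leq_trans (leq_imset_card scale _).
apply/subset_leq_card/subsetP=> g /andP[_ /= /eqP gE].
have [s' E gs] := phiP g; rewrite gE in E; case: E => E; rewrite -{s'}E in gs.
have [s' E hs'] := phiP h; rewrite (eqP hs) in E; case: E => E; rewrite -{s'}E in hs'.
have [a a0 ghE] := @induces_agree3 g h s s
  (Ordinal (isT : 0 < 6)) (Ordinal (isT : 1 < 6)) (Ordinal (isT : 2 < 6)) gs hs'
  isT isT isT erefl erefl erefl.
apply/imsetP; exists a; first by rewrite !inE.
by apply: val_inj; rewrite /scale -ghE /= val_insubd GL_unit.
Qed.

Lemma star_ball_PGL25 :
  #|PGL25 pt| <= 120 /\ star_ball 5 6 * PGL25 pt = setT.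
Proof.
pose f (z : 'S_6 * 'S_6) := z.1 * z.2.
have cardS : #|{: 'S_6}| = 720 by rewrite card_Sn.
have f_inj : {in setX (star_ball 5 6) (PGL25 pt) &, injective f}.
  move=> [h s] [h' s']; rewrite !in_setX /f /= => /andP[Hh Ps] /andP[Hh' Ps'] E.
  have [j _ hE] := star_ballP _ (leqnn _) Hh.
  have [j' _ hE'] := star_ballP _ (leqnn _) Hh'.
  (* In [h * s] the factor [h] acts first and moves at most 0 and [j]; likewise [h'] moves at most 0
     and [j']. At least three of the six points remain, enough for [PGL25_agree3]. *)
  have agree i : i \notin [set ord0; j; j'] -> s i = s' i.
    rewrite !inE !negb_or => /andP[/andP[i0 ij] ij'].
    have := congr1 (fun t : 'S_6 => t i) E; rewrite !permM hE hE'.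
    by rewrite !tpermD // eq_sym.
  have : 2 < #|~: [set ord0; j; j']|.
    rewrite -(leq_add2l #|[set ord0; j; j']|) cardsC card_ord.
    rewrite -[6]/(3 + 3)%N leq_add2r -setUA !cardsU1 cards1.
    by case: (_ \notin _); case: (_ \notin _).
  case/card_gt2P=> [x [y [z [[cx cy cz] [xy yz zx]]]]].
  have Es : s = s'.
    apply: (PGL25_agree3 Ps Ps' xy zx); rewrite 1?eq_sym //; apply: agree; by rewrite -in_setC.
  by move: E; rewrite Es => /mulIg ->.
have cardf : #|f @: setX (star_ball 5 6) (PGL25 pt)| = (6 * #|PGL25 pt|)%N.
  by rewrite card_in_imset // cardsX card_star_ball.
(* Injectivity bounds the order from above; with [PGL25_ge120] the product then fills all 720
   permutations. *)
have le120 : #|PGL25 pt| <= 120.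
  by rewrite -(leq_pmul2l (isT : 0 < 6)) -cardf -[(6 * 120)%N]cardS max_card.
split=> //; apply/eqP; rewrite eqEcard subsetT cardsT cardS.
apply: leq_trans (_ : 720 <= #|f @: setX (star_ball 5 6) (PGL25 pt)|) _.
  by rewrite cardf -[720]/(6 * 120)%N leq_pmul2l ?PGL25_ge120.
apply/subset_leq_card/subsetP=> _ /imsetP[[h s] /setXP[Hh Ps] ->].
exact: mem_mulg.
Qed.

End ProjectiveLine.

(** * The code in [Sym_n], lifted from the factorisation of [Sym_6] *)

Theorem mainTheorem3 (n : nat) (hn : 6 <= n)
    (pt : 'I_6 -> proj_point) (hpt : bijective pt) :
  exists C : {set 'S_n},
    perfect_code (star_graph n) n.-1 C
    /\ exists A : {set 'S_n},
         C = \bigcup_(p in A) (p *: Sym6_embed hn (PGL25 pt))%g.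
Proof.
case: n hn => [|n] // hn /=.
have [leP covP] := star_ball_PGL25 hpt.
set P := Sym6_embed hn (PGL25 pt).
have cov6 : fixes_from n 6 \subset (star_ball n 6 * P)%g.
  apply/subsetP=> _ /fixes_fromP/(fixes_from6_extend hn)[s ->].
  have /mulsgP[h g Hh Pg ->] : s \in (star_ball 5 6 * PGL25 pt)%g by rewrite covP inE.
  have [j _ hE] := star_ballP _ (leqnn _) Hh.
  rewrite extendM mem_mulg //; last by rewrite /P Sym6_embedE imset_f.
  rewrite hE extend_tperm; apply/star_ballP => //.
  by exists (widen_ord hn j); [rewrite /= ltn_ord | congr (tperm _ _); apply: val_inj].
have [B [cB covB]] := star_swap_cover (m := 6) hn cov6.
exists (B * P)%g; split; last first.
  exists B; apply/setP=> x; apply/mulsgP/bigcupP => [[b p Bb Pp ->] | [b Bb /lcosetP[p Pp ->]]].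
    by exists b => //; apply/lcosetP; exists p.
  by exists b p.
apply: perfect_star_code covB; first exact: (@leq_trans 5).
(* [cB] bounds [#|B| * 5!] by [n!], and [P] has at most [120 = 5!] elements. *)
apply: leq_trans cB; apply: leq_trans (leq_card_mulg _ _) _.
rewrite leq_mul2l; apply/orP; right.
by rewrite /P Sym6_embedE (leq_trans (leq_imset_card _ _)).
Qed.
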